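(* The variety $\mathcal{T}_1$ of commutative, idempotent groupoids satisfying $x(x(yz))\approx(x(xy))z$ is the regularization of the variety of squags.
   Context: A groupoid is a set with one binary operation, written as juxtaposition; idempotent means $xx\approx x$. A squag (Steiner quasigroup) is a commutative, idempotent groupoid satisfying $x(xy)\approx y$. An identity is regular if the same variables appear on both sides. The regularization of a variety $\mathcal{V}$ is the variety (of the same similarity type) defined by all regular identities that hold in $\mathcal{V}$. *)

(* Defs.v *)
From mathcomp Require Import all_boot.

Set Implicit Arguments.
Unset Strict Implicit.
Unset Printing Implicit Defensive.

Local Open Scope group_scope.

(* Groupoids (sets with one binary operation) are MathComp magmas; juxtaposition
   is [*] in group_scope.  A variety of groupoids is represented by its
   membership predicate. *)
Definition groupoid_class : Type := magmaType -> Prop.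

Inductive term : Type :=
| Var of nat
| Mul of term & term.

Fixpoint vars (t : term) : seq nat :=
  match t with
  | Var i => [:: i]
  | Mul t1 t2 => vars t1 ++ vars t2
  end.

Fixpoint eval (A : magmaType) (v : nat -> A) (t : term) : A :=
  match t with
  | Var i => v i
  | Mul t1 t2 => eval v t1 * eval v t2
  end.

(* A pair of terms [s], [t] stands for the identity s ≈ t. *)
Definition satisfies (A : magmaType) (s t : term) : Prop :=
  forall v : nat -> A, eval v s = eval v t.

Definition holds_in (V : groupoid_class) (s t : term) : Prop :=
  forall A : magmaType, V A -> satisfies A s t.

Definition regular (s t : term) : Prop := vars s =i vars t.

Definition regularization (V : groupoid_class) : groupoid_class :=
  fun A => forall s t : term, regular s t -> holds_in V s t -> satisfies A s t.

Definition squag : groupoid_class := fun A =>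
  [/\ commutative (fun x y : A => x * y),
      idempotent_op (fun x y : A => x * y)
    & forall x y : A, x * (x * y) = y].

Definition T1 : groupoid_class := fun A =>
  [/\ commutative (fun x y : A => x * y),
      idempotent_op (fun x y : A => x * y)
    & forall x y z : A, x * (x * (y * z)) = (x * (x * y)) * z].

(* Main.v *)
Require Import Defs.
From HB Require Import structures.
From mathcomp Require Import all_boot.
From Stdlib Require Import ProofIrrelevance.

(** The three axioms of [T1] are regular identities that hold in squags, which
    gives one implication.

    For the other one, write [P_x y] for [x (x y)].  In a squag [P_x] is the
    identity; in an algebra of [T1], [P] plays the role of a Plonka partition
    function, splitting the algebra into squags indexed by a semilattice.  The
    axiom reads [P_x (y z) = (P_x y) z = y (P_x z)], and everything follows from
    this way of sliding [P_x] along a product: [P_x] is an idempotent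
    endomorphism, the maps [P_x] commute, and, the crucial point
    ([dbl_mul]), [P_(x y)] is the composite of [P_x] and [P_y].  Hence
    [P_(u(v))], for a term [u] evaluated at [v], depends only on the set of
    variables of [u], and it fixes the value at [v] of every term with the
    same variables as [u].

    Given a regular identity [s = t] of squags and a valuation [v], put
    [e = s(v)].  The elements [x] with [P_e x = x] and [P_x e = e] form a squag
    containing [P_e (v i)] for each variable [i] of [s] and [t].  Evaluating
    both terms in this squag gives [P_e (s(v)) = P_e (t(v))], because [P_e] is
    an endomorphism, and [P_e] fixes both [s(v)] and [t(v)]. *)

Set Implicit Arguments.
Unset Strict Implicit.
Unset Printing Implicit Defensive.

Local Open Scope group_scope.

(** * Squaring translations in T1 *)

Definition dbl (A : magmaType) (x y : A) : A := x * (x * y).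

Section T1Theory.

Variables (A : magmaType) (T1A : T1 A).
Implicit Types x y z e : A.

Let mulC x y : x * y = y * x. Proof. by case: T1A. Qed.
Let mulxx x : x * x = x. Proof. by case: T1A => _ /(_ x). Qed.

Lemma dblMl x y z : dbl x (y * z) = dbl x y * z.
Proof. by case: T1A => _ _; apply. Qed.

Lemma dblMr x y z : dbl x (y * z) = y * dbl x z.
Proof. by rewrite mulC dblMl mulC. Qed.

Lemma dblxx x : dbl x x = x.
Proof. by rewrite /dbl !mulxx. Qed.

Lemma dbl_mull x y : dbl x (x * y) = x * y.
Proof. by rewrite dblMl dblxx. Qed.

Lemma dbl_mulr x y : dbl y (x * y) = x * y.
Proof. by rewrite dblMr dblxx. Qed.

Lemma dbl_idem x y : dbl x (dbl x y) = dbl x y.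
Proof. exact: dbl_mull. Qed.

Lemma dblM x y z : dbl x (y * z) = dbl x y * dbl x z.
Proof. by rewrite -(dbl_idem x (y * z)) dblMr dblMl. Qed.

Lemma dblCA x y z : dbl x (dbl y z) = dbl y (dbl x z).
Proof. by rewrite [dbl y z]/dbl 2!dblMr. Qed.

Lemma dbl_dbl x y z : dbl (dbl x y) z = dbl x (dbl y z).
Proof. by rewrite -[LHS]/(dbl x y * (dbl x y * z)) -(dblMl x y z) -dblM. Qed.

(** Computing [P_(x y) x] by sliding [P_x] out of [(x y) (x (x y))] gives
    [P_y x].  Applying [P] to both sides shows that [P_(x y) P_x = P_y P_x].
    Composing on the right with [P_y], the right-hand side becomes
    [P_y P_x P_y = P_x P_y]; on the left [P_x P_y] is absorbed by [P_(x y)], as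
    both [P_x] and [P_y] fix [x y]. *)
Lemma dbl_mul x y z : dbl (x * y) z = dbl x (dbl y z).
Proof.
have mul_absorb : dbl (x * y) z = dbl (x * y) (dbl x (dbl y z)).
  rewrite -{1}(dbl_mull x y) -{1}(dbl_mulr x y) !dbl_dbl.
  by rewrite (dblCA y) dblCA.
have dbl_mul_fst : dbl (x * y) x = dbl y x.
  rewrite -[LHS]/(x * y * (x * y * x)) [x * y * x]mulC -[x * (x * y)]/(dbl x y).
  by rewrite -dblMr [x * y * y]mulC [x * y]mulC -/(dbl y x) dblCA dblxx.
by rewrite mul_absorb -dbl_dbl dbl_mul_fst dbl_dbl dblCA dbl_idem.
Qed.

(** * The fibers are squags *)

(** Equivalently, [P_e] and [P_x] are the same map. *)
Definition in_fiber e x : Prop := dbl e x = x /\ dbl x e = e.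

(** Closure under products is where [dbl_mul] enters:
    [P_(x y) e = P_x (P_y e) = e]. *)
Lemma in_fiberM e x y : in_fiber e x -> in_fiber e y -> in_fiber e (x * y).
Proof.
by move=> [ex xe] [_ ye]; split; [rewrite dblMl ex | rewrite dbl_mul ye].
Qed.

(** Equality on [A] need not be decidable, so membership is a proposition
    instead of a boolean, and [fiber_inj] rests on proof irrelevance. *)
Definition fiber e : Type := {x : A | in_fiber e x}.

Definition fiber_mul e (x y : fiber e) : fiber e :=
  exist _ (sval x * sval y) (in_fiberM (svalP x) (svalP y)).

Definition fiber_magma e : magmaType :=
  HB.pack (fiber e) (hasMul.Build (fiber e) (@fiber_mul e)).

Lemma fiber_inj e (x y : fiber e) : sval x = sval y -> x = y.
Proof. by case: x y => [x xP] [y yP] /=; apply: subset_eq_compat. Qed.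

(** For [x] and [y] in the fiber of [e], [P_x y = P_x (P_e y) = P_(P_x e) y],
    which is [P_e y = y]. *)
Lemma fiber_squag e : squag (fiber_magma e).
Proof.
split=> [x y|x|[x [ex xe]] [y [ey ye]]]; apply: fiber_inj => /=.
- exact: mulC.
- exact: mulxx.
- by rewrite -/(dbl x y) -ey -dbl_dbl xe.
Qed.

(** * Terms *)

(** At each product node [P_(v i)] slides into a factor containing the
    variable, down to a leaf where [P_(v i) (v i) = v i]. *)
Lemma dbl_eval_var (v : nat -> A) u i :
  i \in vars u -> dbl (v i) (eval v u) = eval v u.
Proof.
elim: u => [j|u1 IH1 u2 IH2] /=; first by rewrite inE => /eqP->; exact: dblxx.
by rewrite mem_cat => /orP[/IH1|/IH2] IH; rewrite ?dblMl ?IH // -dblMl dblMr IH.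
Qed.

Lemma dbl_eval_fix (v : nat -> A) u x :
  (forall i, i \in vars u -> dbl (v i) x = x) -> dbl (eval v u) x = x.
Proof.
elim: u => [j|u1 IH1 u2 IH2] /= fix_x; first by rewrite fix_x ?inE.
by rewrite dbl_mul IH2 ?IH1 // => i iu; apply: fix_x; rewrite mem_cat iu ?orbT.
Qed.

Lemma dbl_eval_subset (v : nat -> A) u u' :
  {subset vars u <= vars u'} -> dbl (eval v u) (eval v u') = eval v u'.
Proof. by move=> uu'; apply: dbl_eval_fix => i /uu'; exact: dbl_eval_var. Qed.

Lemma in_fiber_self e : in_fiber e e.
Proof. by split; exact: dblxx. Qed.

Lemma in_fiber_dbl e x : dbl x e = e -> in_fiber e (dbl e x).
Proof. by move=> xe; split; rewrite ?dbl_idem // dbl_dbl xe dblxx. Qed.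

(** [P_e] is an endomorphism.  The agreement of [w] with [P_e v] is only asked
    on the variables of [u], as the other [P_e (v i)] may lie outside the fiber. *)
Lemma eval_fiber e (v : nat -> A) (w : nat -> fiber_magma e) u :
    (forall i, i \in vars u -> sval (w i) = dbl e (v i)) ->
  sval (eval w u) = dbl e (eval v u).
Proof.
elim: u => [j|u1 IH1 u2 IH2] /= wv; first by rewrite wv ?inE.
by rewrite dblM IH1 ?IH2 // => i iu; apply: wv; rewrite mem_cat iu ?orbT.
Qed.

Lemma T1_regularization_squag : regularization squag A.
Proof.
move=> s t st_vars st_squag v.
pose e := eval v s.
have v_fiber i : i \in vars s -> in_fiber e (dbl e (v i)).
  by move=> /dbl_eval_var is_fix; exact: in_fiber_dbl.
(* A variable that does not occur in [s] need not project into the fiber; it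
   is sent to [e] instead. *)
pose w i : fiber_magma e :=
  match @idP (i \in vars s) with
  | ReflectT i_s => exist _ _ (v_fiber i i_s)
  | ReflectF _ => exist _ _ (in_fiber_self e)
  end.
have wE i : i \in vars s -> sval (w i) = dbl e (v i).
  by rewrite /w; case: {-}_ / idP.
have := congr1 sval (st_squag _ (fiber_squag e) w).
rewrite !(@eval_fiber e v) //; last by move=> i; rewrite -st_vars; exact: wE.
by rewrite !dbl_eval_subset // => i; rewrite st_vars.
Qed.

End T1Theory.

Lemma regularization_squag_T1 (A : magmaType) : regularization squag A -> T1 A.
Proof.
move=> regA; pose x := Var 0; pose y := Var 1; pose z := Var 2.
pose val (a b c : A) i := nth c [:: a; b] i.
split=> [a b|a|a b c].
- apply: (regA (Mul x y) (Mul y x) _ _ (val a b a)) => [i|B [mulC _ _] v] /=.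
    by rewrite !inE orbC.
  exact: mulC.
- apply: (regA (Mul x x) x _ _ (val a a a)) => [i|B [_ mulxx _] v] /=.
    by rewrite !inE orbb.
  exact: mulxx.
- apply: (regA (Mul x (Mul x (Mul y z))) (Mul (Mul x (Mul x y)) z) _ _
    (val a b c)) => [i|B [_ _ mulK] v] /=.
    by rewrite !inE.
  by rewrite !mulK.
Qed.

Theorem theorem6p7 (A : magmaType) : T1 A <-> regularization squag A.
Proof.
by split; [exact: T1_regularization_squag | exact: regularization_squag_T1].
Qed.
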